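(* Let $1\le M\le L$, $1\le l_1<\dots<l_M\le L$, $\mu_1,\dots,\mu_M\in\Lambda$, and assume $b_-(\xi_i,\xi_j)\ne0$ for all $i\neq j$. Then the domain wall partition function of type $B$, $$Z^{(B)}_M(\{\mu\},\{\xi_l\})=\langle1|B_{l_1\dots l_M}(\mu_1)\cdots B_{l_1\dots l_M}(\mu_M)|0\rangle,$$ is given by $$Z^{(B)}_M(\{\mu\},\{\xi_l\})=\sum_{\sigma\in S_M}\ \prod_{i=1}^Mc_+(\mu_i,\xi_{l_{\sigma_i}})\prod_{1\le j<k\le M}\frac{b_-(\mu_k,\xi_{l_{\sigma_j}})\,a_-(\mu_j,\xi_{l_{\sigma_k}})}{b_-(\xi_{l_{\sigma_k}},\xi_{l_{\sigma_j}})\,\theta(\xi_{l_{\sigma_j}},\xi_{l_{\sigma_k}})}.$$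
   Context: Weights. Let $\Lambda$ be a set and $a_-,b_\pm,c_\pm:\Lambda\times\Lambda\to\mathbb C$ functions. Let $R(\lambda_1,\lambda_2)\in\mathrm{End}(\mathbb C^2\otimes\mathbb C^2)$ be, in the ordered basis $(e_1\otimes e_1,e_1\otimes e_2,e_2\otimes e_1,e_2\otimes e_2)$, $$R=\begin{pmatrix}1&0&0&0\\0&b_+&c_+&0\\0&c_-&b_-&0\\0&0&0&a_-\end{pmatrix}(\lambda_1,\lambda_2).$$ For labelled copies $V_i\cong\mathbb C^2$, $R_{ij}(\lambda,\lambda')$ denotes $R(\lambda,\lambda')$ acting on $V_i\otimes V_j$ (first tensor factor $=V_i$, second $=V_j$) and trivially elsewhere. Standing assumptions, for all $\lambda_i\in\Lambda$: unitarity $R_{12}(\lambda_1,\lambda_2)R_{21}(\lambda_2,\lambda_1)=I$, and the Yang-Baxter equation $R_{12}(\lambda_1,\lambda_2)R_{13}(\lambda_1,\lambda_3)R_{23}(\lambda_2,\lambda_3)=R_{23}(\lambda_2,\lambda_3)R_{13}(\lambda_1,\lambda_3)R_{12}(\lambda_1,\lambda_2)$. (Unitarity gives $a_-(\lambda,\lambda')a_-(\lambda',\lambda)=1$.) Fix $\xi_1,\dots,\xi_L\in\Lambda$, $\xi_i$ attached to $V_i$. With an auxiliary space $V_a\cong\mathbb C^2$, $R_{a l_M}(\mu,\xi_{l_M})\cdots R_{a l_1}(\mu,\xi_{l_1})=\begin{pmatrix}A_{l_1\dots l_M}(\mu)&B_{l_1\dots l_M}(\mu)\\C_{l_1\dots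 l_M}(\mu)&D_{l_1\dots l_M}(\mu)\end{pmatrix}_a$, a $2\times 2$ matrix in $V_a$ with entries in $\mathrm{End}(V_{l_1}\otimes\dots\otimes V_{l_M})$. Reference states on $V_{l_1}\otimes\dots\otimes V_{l_M}$: $|0\rangle=\bigotimes_i e_1$, and $\langle1|$ is the transpose of $\bigotimes_i e_2$. The function $\theta$ depends on the order of the indices: $\theta(\xi_i,\xi_j)=a_-(\xi_i,\xi_j)$ if $i<j$ and $\theta(\xi_i,\xi_j)=1$ if $i\ge j$. For $\sigma\in S_M$, $\sigma_i=\sigma(i)$. *)

(* Defs.v *)
From mathcomp Require Import all_boot all_order all_fingroup all_algebra.
From mathcomp Require Import reals.
From mathcomp.real_closed Require Import complex mxtens.

Set Implicit Arguments.
Unset Strict Implicit.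
Unset Printing Implicit Defensive.

Import GRing.Theory.
Local Open Scope ring_scope.

(* [TensorSpace I] is the tensor product of copies V_i of C^2 indexed by the
   finite type [I]. Its standard basis consists of the configurations
   x : {ffun I -> 'I_2}, standing for the tensor of the e_(x i) with the
   convention e_1 = [ord0] and e_2 = [ord_max] of 'I_2. The coordinate [p] of a
   vector or of a matrix is the configuration [conf p]. *)
Notation config I := {ffun I -> 'I_2}.

Notation TensorSpace K I := 'cV[K]_#|config I|.
Notation TensorEnd K I := 'M[K]_#|config I|.

Definition conf (I : finType) (p : 'I_#|config I|) : config I := enum_val p.

Section Tensors.
Variables (K : fieldType) (I : finType).

Definition tensor (v : I -> 'cV[K]_2) : TensorSpace K I :=
  \col_p \prod_(i : I) v i (conf p i) 0.

Definition e1 : 'cV[K]_2 := delta_mx ord0 0.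
Definition e2 : 'cV[K]_2 := delta_mx ord_max 0.

(* [act_on i j X], for i != j: the endomorphism X of C^2 (x) C^2 acting on
   V_i (x) V_j, with V_i as first tensor factor whatever the order of i and j,
   and as the identity on the other factors. The ordered basis of C^2 (x) C^2
   is that of [mxtens_index]: e1e1, e1e2, e2e1, e2e2. *)
Definition act_on (i j : I) (X : 'M[K]_(2 * 2)) : TensorEnd K I :=
  \matrix_(p, q)
    let x := conf p in let y := conf q in
    X (mxtens_index (x i, x j)) (mxtens_index (y i, y j))
      *+ [forall k, (k != i) && (k != j) ==> (x k == y k)].

(* With an auxiliary space V_a labelled by [None], an endomorphism of
   V_a (x) (tensor product over I) is a 2 x 2 matrix in V_a with entries
   [aux_entry s t T], where s is the row and t the column. *)
Definition with_aux (s : 'I_2) (x : config I) : config (option I) :=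
  [ffun k => if k is Some i then x i else s].

Definition aux_entry (s t : 'I_2) (T : TensorEnd K (option I)) : TensorEnd K I :=
  \matrix_(p, q) T (enum_rank (with_aux s (conf p)))
                   (enum_rank (with_aux t (conf q))).

End Tensors.

Arguments e1 {K}.
Arguments e2 {K}.

Record weights (Lambda : Type) (K : fieldType) := Weights {
  a_minus : Lambda -> Lambda -> K;
  b_plus : Lambda -> Lambda -> K;
  b_minus : Lambda -> Lambda -> K;
  c_plus : Lambda -> Lambda -> K;
  c_minus : Lambda -> Lambda -> K
}.

Section VertexModel.
Variables (Lambda : Type) (K : fieldType) (w : weights Lambda K).

Definition Rmatrix (x y : Lambda) : 'M[K]_(2 * 2) :=
  \matrix_(p, q) nth 0 (nth [::]
    [:: [:: 1; 0;             0;             0             ];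
        [:: 0; b_plus w x y;  c_plus w x y;  0             ];
        [:: 0; c_minus w x y; b_minus w x y; 0             ];
        [:: 0; 0;             0;             a_minus w x y ]] p) q.

Definition Rop (I : finType) (i j : I) (x y : Lambda) : TensorEnd K I :=
  act_on i j (Rmatrix x y).

Definition unitarity : Prop :=
  let V1 : 'I_2 := inord 0 in let V2 : 'I_2 := inord 1 in
  forall x1 x2 : Lambda, Rop V1 V2 x1 x2 *m Rop V2 V1 x2 x1 = 1%:M.

Definition yang_baxter : Prop :=
  let V1 : 'I_3 := inord 0 in let V2 : 'I_3 := inord 1 in
  let V3 : 'I_3 := inord 2 in
  forall x1 x2 x3 : Lambda,
    Rop V1 V2 x1 x2 *m Rop V1 V3 x1 x3 *m Rop V2 V3 x2 x3 =
    Rop V2 V3 x2 x3 *m Rop V1 V3 x1 x3 *m Rop V1 V2 x1 x2.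

(* [z k] is the inhomogeneity attached to the [k]-th quantum space. The product
   runs through the factors from left to right, hence [rev_ord]: the last site
   comes first. *)
Definition monodromy (M : nat) (z : 'I_M -> Lambda) (mu : Lambda) :
    TensorEnd K (option 'I_M) :=
  \prod_(k < M) Rop None (Some (rev_ord k)) mu (z (rev_ord k)).

Definition Bop (M : nat) (z : 'I_M -> Lambda) (mu : Lambda) : TensorEnd K 'I_M :=
  aux_entry ord0 ord_max (monodromy z mu).

Definition ket0 (M : nat) : TensorSpace K 'I_M := tensor (fun _ => e1).
Definition bra1 (M : nat) : 'rV[K]_#|config 'I_M| := (tensor (fun _ => e2))^T.

Definition ZB (M : nat) (mu z : 'I_M -> Lambda) : K :=
  (bra1 M *m (\prod_(k < M) Bop z (mu k)) *m ket0 M) 0 0.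

(* A function of the indices, not only of the values xi i and xi j. *)
Definition theta (L : nat) (xi : 'I_L -> Lambda) (i j : 'I_L) : K :=
  if (i < j)%N then a_minus w (xi i) (xi j) else 1.

End VertexModel.

(* Main.v *)
(* Let T be the monodromy matrix and let X_n be the product of the R-matrices
   moving the site n to the first place; by the Yang-Baxter equation X_n
   intertwines the two orderings of T.  When n is the first site and carries
   e_2, every B(mu) acts as a_-(mu, z_n) times the B(mu) of the remaining sites.
   On the other hand
     B(mu)|0> = sum_n c_+(mu, z_n)
                  prod_(i <> n) b_-(mu, z_i) / b_-(z_n, z_i) X_n |n>,
   with |n> the state having e_2 at n and e_1 elsewhere: this amounts to a
   partial-fraction identity between c_+ and b_-, which follows by induction from
   one matrix entry of the Yang-Baxter equation.  Applying it to the last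
   operator B(mu_M), together with <1| X_n = prod_(i < n) a_-(z_n, z_i) <1|,
   expresses Z_M through the functions Z_(M-1) of the sites other than
   n = sigma_M. *)
Require Import Defs.
From mathcomp Require Import all_boot all_order all_fingroup all_algebra.
From mathcomp Require Import reals.
From mathcomp.real_closed Require Import complex mxtens.
From mathcomp Require Import ring zify.
Import GRing.Theory.
Local Open Scope ring_scope.

(** * The standard basis, and embeddings of sites *)

Definition upd {I : finType} (x : config I) (i : I) (s : 'I_2) : config I :=
  [ffun k => if k == i then s else x k].

Lemma updE {I : finType} (x : config I) i s k :
  upd x i s k = if k == i then s else x k.
Proof. by rewrite ffunE. Qed.

Lemma updC {I : finType} (x : config I) i j s t : i != j ->
  upd (upd x i s) j t = upd (upd x j t) i s.
Proof.
move=> nij; apply/ffunP => k; rewrite !ffunE.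
by case: eqP => // ->; rewrite eq_sym (negbTE nij).
Qed.

Section Kets.
Context {K : fieldType} {I : finType}.
Implicit Types (x y : config I) (A B : TensorEnd K I).

Definition ket x : TensorSpace K I := delta_mx (enum_rank x) 0.
Definition bra x : 'rV[K]_#|config I| := delta_mx 0 (enum_rank x).

Lemma bra_ket x y : bra x *m ket y = (x == y)%:R%:M.
Proof.
apply/matrixP => i j; rewrite !ord1 /bra /ket -rowE !mxE eqxx andbT mulr1n.
by rewrite (inj_eq enum_rank_inj).
Qed.

Lemma sum_conf (V : nmodType) (F : 'I_#|config I| -> V) :
  \sum_p F p = \sum_x F (enum_rank x).
Proof.
by apply: reindex; exists enum_val => ? _; rewrite (enum_rankK, enum_valK).
Qed.

Lemma ket_ext A B : (forall y, A *m ket y = B *m ket y) -> A = B.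
Proof.
move=> AB; apply/matrixP => p q; move: (AB (conf q)).
by rewrite /ket /conf enum_valK -!colE => /matrixP /(_ p 0); rewrite !mxE.
Qed.

Lemma conf_rank x : conf (enum_rank x) = x.
Proof. exact: enum_rankK. Qed.

(** The Boolean in [act_on] keeps exactly the rows that agree with [y] off [i] and [j]. These are
    the updates of [y] at the two sites, each obtained once because [i != j]. *)
Lemma act_on_ket (i j : I) (X : 'M[K]_(2 * 2)) y : i != j ->
  act_on i j X *m ket y =
  \sum_st X (mxtens_index st) (mxtens_index (y i, y j)) *:
     ket (upd (upd y i st.1) j st.2).
Proof.
move=> nij; rewrite /ket -colE; apply/matrixP => p q; rewrite ord1 !mxE /= conf_rank.
rewrite summxE; set x := conf p.
have Ep : p = enum_rank x by rewrite /x /conf enum_valK.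
rewrite (eq_bigr (fun st => X (mxtens_index st) (mxtens_index (y i, y j)) *
    (x == upd (upd y i st.1) j st.2)%:R)) => [|st _]; last first.
  by rewrite !mxE Ep eqxx andbT (inj_eq enum_rank_inj).
case: (boolP [forall _, _]) => [/forallP H|/forallP H].
  rewrite (bigD1 (x i, x j)) //= big1 ?addr0.
    suff -> : x == upd (upd y i (x i)) j (x j) by rewrite mulr1.
    apply/eqP/ffunP => k; rewrite !updE; case: eqP => [->//|/eqP kj].
    by case: eqP => [->//|/eqP ki]; move: (H k); rewrite ki kj => /eqP.
  move=> [s t] ne; case: eqP => [e|]; rewrite ?mulr0 //.
  case/negP: ne; apply/eqP; congr (_, _); rewrite e !updE ?eqxx //=.
  by rewrite (negbTE nij).
rewrite big1 // => st _; case: eqP => [e|]; rewrite ?mulr0 //.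
case: H => k; rewrite e !updE; apply/implyP => /andP[/negbTE-> /negbTE->] //.
Qed.

(** Each operator reads and changes only its own two sites, so on a basis vector both orders give
    the same double sum. *)
Lemma act_onC (i j k l : I) (X Y : 'M[K]_(2 * 2)) :
  i != j -> k != l -> i != k -> i != l -> j != k -> j != l ->
  act_on i j X *m act_on k l Y = act_on k l Y *m act_on i j X.
Proof.
move=> ij kl ik il jk jl; apply: ket_ext => y.
rewrite -!mulmxA !act_on_ket // !mulmx_sumr.
under eq_bigr => st _ do rewrite -scalemxAr act_on_ket // scaler_sumr.
under [RHS]eq_bigr => st _ do rewrite -scalemxAr act_on_ket // scaler_sumr.
rewrite exchange_big; apply: eq_bigr => st _; apply: eq_bigr => st' _.
rewrite !scalerA mulrC !updE (negbTE ik) (negbTE il) (negbTE jk) (negbTE jl).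
rewrite ![_ == i]eq_sym ![_ == j]eq_sym (negbTE ik) (negbTE il) (negbTE jk) (negbTE jl).
congr (_ *: ket _); rewrite (updC _ l i) 1?eq_sym //.
by rewrite (updC _ k i) 1?eq_sym // (updC _ l j) 1?eq_sym // (updC _ k j) 1?eq_sym.
Qed.

End Kets.

Section Embed.
Context {K : fieldType} {J I : finType} (f : J -> I).
Hypothesis f_inj : injective f.

Definition pull (x : config I) : config J := [ffun j => x (f j)].

Definition glue (y : config I) (v : config J) : config I :=
  [ffun i => if [pick j | f j == i] is Some j then v j else y i].

Lemma glue_f y v j : glue y v (f j) = v j.
Proof.
rewrite ffunE; case: pickP => [j' /eqP/f_inj->//|/(_ j)]; by rewrite eqxx.
Qed.

Lemma glue_out y v i : i \notin codom f -> glue y v i = y i.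
Proof.
move=> ni; rewrite ffunE; case: pickP => // j /eqP e.
by rewrite -e codom_f in ni.
Qed.

Lemma pull_glue y v : pull (glue y v) = v.
Proof. by apply/ffunP => j; rewrite ffunE glue_f. Qed.

Lemma glue_glue y v v' : glue (glue y v) v' = glue y v'.
Proof. by apply/ffunP => i; rewrite !ffunE; case: pickP. Qed.

(** This is [A] on the sites in the image of [f], tensored with the identity elsewhere. It carries
    the Yang-Baxter equation, stated on three sites, to any three distinct sites. *)
Definition embed (A : TensorEnd K J) : TensorEnd K I :=
  \matrix_(p, q) (A (enum_rank (pull (conf p))) (enum_rank (pull (conf q)))
    *+ [forall i, (i \notin codom f) ==> (conf p i == conf q i)]).

Lemma embed_ket A y : embed A *m ket y =
  \sum_v A (enum_rank v) (enum_rank (pull y)) *: ket (glue y v).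
Proof.
rewrite /ket -colE; apply/matrixP => p q; rewrite ord1 !mxE conf_rank summxE.
set x := conf p; have Ep : p = enum_rank x by rewrite /x /conf enum_valK.
rewrite (eq_bigr (fun v => A (enum_rank v) (enum_rank (pull y)) *
    (x == glue y v)%:R)) => [|v _]; last first.
  by rewrite !mxE Ep eqxx andbT (inj_eq enum_rank_inj).
case: (boolP [forall _, _]) => [/forallP H|/forallP H].
  rewrite (bigD1 (pull x)) //= big1 ?addr0.
    suff -> : x == glue y (pull x) by rewrite mulr1.
    apply/eqP/ffunP => i; case: (boolP (i \in codom f)) => [/codomP[j ->]|ni].
      by rewrite glue_f ffunE.
    by rewrite glue_out //; move: (H i); rewrite ni => /eqP.
  move=> v ne; case: eqP => [e|]; rewrite ?mulr0 //.
  by case/negP: ne; rewrite e pull_glue.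
rewrite big1 // => v _; case: eqP => [e|]; rewrite ?mulr0 //.
by case: H => i; apply/implyP => ni; rewrite e glue_out.
Qed.

Lemma embedM A B : embed (A *m B) = embed A *m embed B.
Proof.
apply: ket_ext => y; rewrite -mulmxA !embed_ket mulmx_sumr.
under [RHS]eq_bigr => v _.
  rewrite -scalemxAr embed_ket scaler_sumr.
  under eq_bigr => u _ do rewrite scalerA glue_glue pull_glue.
over.
rewrite exchange_big; apply: eq_bigr => u _ /=.
rewrite -scaler_suml; congr (_ *: _); rewrite mxE sum_conf.
by apply: eq_bigr => v _; rewrite mulrC.
Qed.

Lemma embed_act_on i j (X : 'M[K]_(2 * 2)) :
  embed (act_on i j X) = act_on (f i) (f j) X.
Proof.
apply/matrixP => p q; rewrite !mxE /= !conf_rank !ffunE -mulrnA mulnb.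
congr (_ *+ _); congr nat_of_bool.
(* Agreement at the sites of [J] other than [i], [j], together with agreement off the image of [f],
   is agreement at all sites of [I] other than [f i], [f j]. *)
apply/andP/forallP => [[/forallP H1 /forallP H2] k|H].
  case: (boolP (k \in codom f)) => [/codomP[j' ->]|nk].
    by rewrite !(inj_eq f_inj); move: (H1 j'); rewrite !ffunE.
  by rewrite (implyP (H2 k) nk) implybT.
split; apply/forallP => k.
  by move: (H (f k)); rewrite !ffunE !(inj_eq f_inj).
apply/implyP => nk; apply: (implyP (H k)).
by apply/andP; split; apply: contraNneq nk => ->; apply: codom_f.
Qed.

End Embed.

(** * The R-matrix on basis vectors and the resulting identities between weights *)

Lemma upd_id {I : finType} (x : config I) i s : x i = s -> upd x i s = x.
Proof. by move=> e; apply/ffunP => k; rewrite updE; case: eqP => [->|]. Qed.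

Lemma upd_upd {I : finType} (x : config I) i s t : upd (upd x i s) i t = upd x i t.
Proof. by apply/ffunP => k; rewrite !updE; case: eqP. Qed.

Lemma ord2P (s : 'I_2) : s = ord0 \/ s = ord_max.
Proof. by case: s => [[|[|//]] H]; [left|right]; apply: val_inj. Qed.

Section LocalAction.
Context {Lambda : Type} {K : fieldType} (w : weights Lambda K) {I : finType}.
Implicit Types (i j : I) (y : config I).

Lemma Rop_ket i j x1 x2 y s t : i != j -> y i = s -> y j = t ->
  let X s' t' := Rmatrix w x1 x2 (mxtens_index (s', t')) (mxtens_index (s, t)) in
  let v s' t' := ket (upd (upd y i s') j t') in
  Rop w i j x1 x2 *m ket y =
  X ord0 ord0 *: v ord0 ord0 + X ord0 ord_max *: v ord0 ord_max +
  (X ord_max ord0 *: v ord_max ord0 + X ord_max ord_max *: v ord_max ord_max).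
Proof.
move=> nij yi yj /=; rewrite /Rop act_on_ket // yi yj.
rewrite (eq_bigr (fun st => (fun s' t' =>
  Rmatrix w x1 x2 (mxtens_index (s', t')) (mxtens_index (s, t)) *:
  ket (upd (upd y i s') j t')) st.1 st.2)) => [|[]//].
rewrite -(pair_bigA _ (fun s' t' =>
  Rmatrix w x1 x2 (mxtens_index (s', t')) (mxtens_index (s, t)) *:
  ket (upd (upd y i s') j t'))) /= !big_ord_recl !big_ord0 !addr0.
by have -> : lift ord0 ord0 = ord_max :> 'I_2 by apply: val_inj.
Qed.

(** In the names of this family the two digits are the states of [i] and [j], with 0 for [e1] and 1
    for [e2]. *)
Lemma Rop_ket00 i j x1 x2 y : i != j -> y i = ord0 -> y j = ord0 ->
  Rop w i j x1 x2 *m ket y = ket y.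
Proof.
move=> nij yi yj; rewrite (Rop_ket i j x1 x2 y _ _ nij yi yj) !mxE /= !scale0r !addr0 scale1r.
by rewrite (upd_id y i _ yi) (upd_id y j _ yj).
Qed.

Lemma Rop_ket10 i j x1 x2 y : i != j -> y i = ord_max -> y j = ord0 ->
  Rop w i j x1 x2 *m ket y =
  b_minus w x1 x2 *: ket y + c_plus w x1 x2 *: ket (upd (upd y i ord0) j ord_max).
Proof.
move=> nij yi yj; rewrite (Rop_ket i j x1 x2 y _ _ nij yi yj) !mxE /= !scale0r add0r addr0 addrC.
by rewrite (upd_id y i ord_max yi) (upd_id y j ord0 yj).
Qed.

Lemma Rop_ket01 i j x1 x2 y : i != j -> y i = ord0 -> y j = ord_max ->
  Rop w i j x1 x2 *m ket y =
  b_plus w x1 x2 *: ket y + c_minus w x1 x2 *: ket (upd (upd y i ord_max) j ord0).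
Proof.
move=> nij yi yj; rewrite (Rop_ket i j x1 x2 y _ _ nij yi yj) !mxE /= !scale0r add0r addr0.
by rewrite (upd_id y i ord0 yi) (upd_id y j ord_max yj).
Qed.

Lemma Rop_ket11 i j x1 x2 y : i != j -> y i = ord_max -> y j = ord_max ->
  Rop w i j x1 x2 *m ket y = a_minus w x1 x2 *: ket y.
Proof.
move=> nij yi yj; rewrite (Rop_ket i j x1 x2 y _ _ nij yi yj) !mxE /= !scale0r !add0r.
by rewrite (upd_id y i _ yi) (upd_id y j _ yj).
Qed.

(** The only nonzero entry in the last row of the R-matrix is [a_minus], on the diagonal. *)
Lemma bra_Rop i j x1 x2 y : i != j -> y i = ord_max -> y j = ord_max ->
  bra y *m Rop w i j x1 x2 = a_minus w x1 x2 *: (bra y : 'rV[K]_#|config I|).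
Proof.
move=> nij yi yj; rewrite /bra -rowE; apply/matrixP => o q; rewrite ord1 !mxE /= conf_rank yi yj.
set x := conf q; have Eq : q = enum_rank x by rewrite /x /conf enum_valK.
rewrite Eq (inj_eq enum_rank_inj).
case: (boolP [forall _, _]) => [/forallP H|/forallP H]; last first.
  rewrite mulr0n; case: eqP => [e|]; rewrite ?mulr0 //.
  by case: H => k; rewrite e eqxx implybT.
have -> : (x == y) = (x i == ord_max) && (x j == ord_max).
  apply/eqP/andP => [->|[/eqP xi /eqP xj]]; first by rewrite yi yj.
  apply/ffunP => k; case: (eqVneq k i) => [->|ki]; first by rewrite xi yi.
  case: (eqVneq k j) => [->|kj]; first by rewrite xj yj.
  by apply/esym/eqP; apply: (implyP (H k)); rewrite ki kj.
by case: (ord2P (x i)) => ->; case: (ord2P (x j)) => -> /=; rewrite ?mulr1 ?mulr0 mxE.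
Qed.

Lemma one_upd_upd y i j : i != j -> y i = ord0 ->
  upd (upd (upd y i ord_max) i ord0) j ord_max = upd y j ord_max.
Proof. by move=> nij yi; rewrite upd_upd (upd_id y i _ yi). Qed.

(** One-excitation sector: [y] is a background with [e1] at [i] and [j], and the R-matrix either
    keeps the single [e2] in place or moves it to the other site. *)
Lemma Rop_one_l i j x1 x2 y : i != j -> y i = ord0 -> y j = ord0 ->
  Rop w i j x1 x2 *m ket (upd y i ord_max) =
  b_minus w x1 x2 *: ket (upd y i ord_max) + c_plus w x1 x2 *: ket (upd y j ord_max).
Proof.
move=> nij yi yj; rewrite Rop_ket10 ?updE ?eqxx //; last by rewrite eq_sym (negbTE nij).
by rewrite one_upd_upd.
Qed.

Lemma Rop_one_r i j x1 x2 y : i != j -> y i = ord0 -> y j = ord0 ->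
  Rop w i j x1 x2 *m ket (upd y j ord_max) =
  b_plus w x1 x2 *: ket (upd y j ord_max) + c_minus w x1 x2 *: ket (upd y i ord_max).
Proof.
move=> nij yi yj; rewrite Rop_ket01 ?updE ?eqxx //; last by rewrite (negbTE nij).
by rewrite (updC _ i j) // upd_upd (upd_id y j _ yj).
Qed.

Lemma Rop_one_out i j k x1 x2 y : i != j -> k != i -> k != j ->
  y i = ord0 -> y j = ord0 ->
  Rop w i j x1 x2 *m ket (upd y k ord_max) = ket (upd y k ord_max).
Proof.
move=> nij ki kj yi yj; rewrite Rop_ket00 // updE eq_sym ?(negbTE ki) //.
by rewrite (negbTE kj).
Qed.

End LocalAction.

(** * Identities between the weights, from unitarity and the Yang-Baxter equation *)

Section Consequences.
Context {Lambda : Type} {K : fieldType} {w : weights Lambda K}.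
Local Notation a := (a_minus w).
Local Notation b := (b_minus w).
Local Notation c := (c_plus w).
Local Notation c' := (c_minus w).

Section Unitarity.
Hypothesis hunit : unitarity w.

Let V1 : 'I_2 := inord 0.
Let V2 : 'I_2 := inord 1.
Let V12 : V1 != V2. Proof. by rewrite -val_eqE /= !inordK. Qed.

(** This is the diagonal entry of unitarity at [e2] on both sites. *)
Lemma a_inv x1 x2 : a x1 x2 * a x2 x1 = 1.
Proof.
pose y : config 'I_2 := [ffun=> ord_max].
have : bra y *m (Rop w V1 V2 x1 x2 *m Rop w V2 V1 x2 x1) *m ket y = 1%:M.
  by rewrite hunit mulmx1 bra_ket eqxx.
rewrite mulmxA bra_Rop ?ffunE // -scalemxAl bra_Rop ?ffunE 1?eq_sym //.
rewrite scalerA -scalemxAl bra_ket eqxx => /matrixP /(_ 0 0).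
by rewrite !mxE /= mulr1.
Qed.

(** This is the off-diagonal entry of unitarity that moves a single [e2] from [V2] to [V1]. It
    serves to eliminate [c_minus]. *)
Lemma bc_unit x1 x2 : c' x1 x2 * b x2 x1 + b x1 x2 * c x2 x1 = 0.
Proof.
pose y : config 'I_2 := [ffun=> ord0].
have yE k : y k = ord0 by rewrite ffunE.
have V21 : V2 != V1 by rewrite eq_sym.
have ne : (upd y V1 ord_max == upd y V2 ord_max) = false.
  by apply/eqP => /ffunP /(_ V2); rewrite !updE (negbTE V21) eqxx ffunE.
have : bra (upd y V1 ord_max) *m (Rop w V1 V2 x1 x2 *m Rop w V2 V1 x2 x1) *m
   ket (upd y V2 ord_max) = 0.
  by rewrite hunit mulmx1 bra_ket ne raddf0.
rewrite -!mulmxA Rop_one_l // mulmxDr -!scalemxAr Rop_one_l // Rop_one_r //.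
rewrite !(mulmxDr, =^~ scalemxAr) !bra_ket !eqxx ne => /matrixP /(_ 0 0).
rewrite !mxE /= !mulr0n !mulr1n !mulr0 !mulr1 add0r addr0 => <-.
by rewrite mulrC [c _ _ * _]mulrC.
Qed.
End Unitarity.

Section YangBaxter.
Hypothesis hYB : yang_baxter w.

(** This is the Yang-Baxter entry moving a single [e2] from [V1] to [V2]. On the left only the
    direct move contributes; on the right the [e2] either passes through [V3] or goes directly to
    [V2]. *)
Lemma bc_ybe x1 x2 x3 :
  c x1 x2 * b x1 x3 = b x1 x2 * c x1 x3 * c' x2 x3 + c x1 x2 * b x2 x3.
Proof.
pose V1 : 'I_3 := inord 0; pose V2 : 'I_3 := inord 1; pose V3 : 'I_3 := inord 2.
have V12 : V1 != V2 by rewrite -val_eqE /= !inordK.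
have V13 : V1 != V3 by rewrite -val_eqE /= !inordK.
have V23 : V2 != V3 by rewrite -val_eqE /= !inordK.
pose y : config 'I_3 := [ffun=> ord0].
have yE k : y k = ord0 by rewrite ffunE.
have ne i j : i != j -> (upd y i ord_max == upd y j ord_max) = false.
  by move=> nij; apply/eqP => /ffunP /(_ i); rewrite !updE (negbTE nij) eqxx ffunE.
move: (hYB x1 x2 x3) => /(congr1 (fun A => bra (upd y V2 ord_max) *m A *m ket (upd y V1 ord_max))).
have o23 := Rop_one_out w V2 V3 V1 x2 x3 y V23 V12 V13 (yE _) (yE _).
have o13 := Rop_one_out w V1 V3 V2 x1 x3 y V13 _ V23 (yE _) (yE _).
have o12 := Rop_one_out w V1 V2 V3 x1 x2 y V12 _ _ (yE _) (yE _).
have l12 := Rop_one_l w V1 V2 x1 x2 y V12 (yE _) (yE _).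
have l13 := Rop_one_l w V1 V3 x1 x3 y V13 (yE _) (yE _).
have l23 := Rop_one_l w V2 V3 x2 x3 y V23 (yE _) (yE _).
have r23 := Rop_one_r w V2 V3 x2 x3 y V23 (yE _) (yE _).
rewrite -/V1 -/V2 -/V3 -!mulmxA o23 l12 l13.
rewrite !(mulmxDr, =^~ scalemxAr) l12 l13 o13 1?eq_sym // o12 1?eq_sym //.
rewrite !(mulmxDr, =^~ scalemxAr) o23 l23 r23.
rewrite !(mulmxDr, =^~ scalemxAr) !bra_ket !eqxx ![_ == upd y V1 _]eq_sym.
rewrite !(ne _ _ V12, ne _ _ V13, ne _ _ V23) => /matrixP /(_ 0 0).
rewrite !mxE /= !mulr0n !mulr1n !mulr0 !mulr1 !addr0 !add0r.
by rewrite mulrC mulrA.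
Qed.

(** The equation on ['I_3] is transported along the injection sending 0, 1, 2 to [i], [j], [k]. *)
Lemma Rop_YBE {I : finType} (i j k : I) x1 x2 x3 : i != j -> i != k -> j != k ->
  Rop w i j x1 x2 *m Rop w i k x1 x3 *m Rop w j k x2 x3 =
  Rop w j k x2 x3 *m Rop w i k x1 x3 *m Rop w i j x1 x2.
Proof.
move=> ij ik jk; pose f := tnth [tuple i; j; k].
have f_inj : injective f.
  apply/injectiveP; rewrite /injectiveb /dinjectiveb map_tnth_enum /=.
  by rewrite !inE negb_or ij ik jk.
have f1 : f (inord 0) = i by rewrite /f (tnth_nth i) /= inordK.
have f2 : f (inord 1) = j by rewrite /f (tnth_nth i) /= inordK.
have f3 : f (inord 2) = k by rewrite /f (tnth_nth i) /= inordK.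
move: (hYB x1 x2 x3) => /(congr1 (embed f)).
by rewrite !embedM // /Rop !embed_act_on // f1 f2 f3.
Qed.
End YangBaxter.

(** In [bc_ybe], unitarity turns [c' x2 x3 / b x2 x3] into [- c x3 x2 / b x3 x2]. The result is the
    partial-fraction identity below for a one-element list. *)
Lemma bc_exchange x1 x2 x3 : unitarity w -> yang_baxter w ->
  b x2 x3 != 0 -> b x3 x2 != 0 ->
  c x1 x2 * (b x1 x3 / b x2 x3) = c x1 x2 - c x1 x3 * b x1 x2 * (c x3 x2 / b x3 x2).
Proof.
move=> hunit hYB b23 b32; rewrite mulrA bc_ybe //.
have -> : c' x2 x3 = - (b x2 x3 * c x3 x2) / b x3 x2.
  by rewrite -(addr0_eq (bc_unit hunit x2 x3)) opprK mulfK.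
by field; rewrite b23 b32.
Qed.

(** Induction on [s]. Exchanging the new point [t] in every product containing its factor creates
    correction terms; these cancel against the term [n = t], expanded by the induction hypothesis at
    [z t]. *)
Lemma bc_partial_fractions {I : eqType} (z : I -> Lambda) (s : seq I) i0 x :
  unitarity w -> yang_baxter w ->
  uniq (i0 :: s) ->
  {in i0 :: s &, forall i j, i != j -> b (z i) (z j) != 0} ->
  c x (z i0) = c x (z i0) * \prod_(i <- s) (b x (z i) / b (z i0) (z i)) +
    \sum_(n <- s) c x (z n) * (b x (z i0) * c (z n) (z i0) / b (z n) (z i0)) *
      \prod_(i <- s | i != n) (b x (z i) / b (z n) (z i)).
Proof.
move=> hunit hYB; elim: s x => [|t s IH] x us hb; first by rewrite !big_nil mulr1 addr0.
move: (us); rewrite /= inE negb_or => /andP[/andP[nt ns] /andP[ts us']].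
have us0 : uniq (i0 :: s) by rewrite /= ns.
have sub : {subset i0 :: s <= i0 :: t :: s}.
  by move=> k; rewrite !inE => /orP[->//|->]; rewrite !orbT.
have hb' : {in i0 :: s &, forall i j, i != j -> b (z i) (z j) != 0}.
  by move=> i j /sub si /sub sj; apply: hb.
have i0i : i0 \in [:: i0, t & s] by rewrite inE eqxx.
have ti : t \in [:: i0, t & s] by rewrite !inE eqxx orbT.
have b0t : b (z i0) (z t) != 0 by apply: hb.
have bt0 : b (z t) (z i0) != 0 by apply: hb => //; rewrite eq_sym.
have bt n : n \in s -> (b (z n) (z t) != 0) /\ (b (z t) (z n) != 0).
  move=> ns'; have nis : n \in [:: i0, t & s] by rewrite !inE ns' !orbT.
  have nent : n != t by apply: contraNneq ts => <-.
  by split; apply: hb => //; rewrite eq_sym.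
(* [E] is the induction hypothesis at [z t], divided by [b (z t) (z i0)] and multiplied by the
   product over [s]; the factors [b (z t) (z i)] cancel. *)
have E : c (z t) (z i0) / b (z t) (z i0) * \prod_(i <- s) (b x (z i) / b (z t) (z i)) =
    c (z t) (z i0) / b (z t) (z i0) * \prod_(i <- s) (b x (z i) / b (z i0) (z i)) +
    \sum_(n <- s) b x (z n) * (c (z t) (z n) / b (z t) (z n)) *
      (c (z n) (z i0) / b (z n) (z i0)) * \prod_(i <- s | i != n) (b x (z i) / b (z n) (z i)).
  rewrite {1}(IH (z t)) // 2!mulrDl; congr (_ + _).
    rewrite -!mulrA; congr (_ * _); rewrite mulrCA; congr (_ * _).
    rewrite -big_split; apply: eq_big_seq => n /bt[_ hn] /=.
    by rewrite mulrC mulrA divfK.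
  rewrite !mulr_suml; apply: eq_big_seq => n hns; have [nt' tn] := bt _ hns.
  set r := \prod_(i <- s) _; pose p := \prod_(i <- s | i != n) (b x (z i) / b (z t) (z i)).
  have -> : r = b x (z n) / b (z t) (z n) * p by rewrite /r (bigD1_seq n).
  have -> : \prod_(i <- s | i != n) (b x (z i) / b (z n) (z i)) =
            p * \prod_(i <- s | i != n) (b (z t) (z i) / b (z n) (z i)).
    rewrite -big_split big_seq_cond [RHS]big_seq_cond; apply: eq_bigr => i /andP[/bt[_ hi] _] /=.
    by rewrite mulrA divfK.
  move: p (\prod_(i <- s | _) _) => p q.
  have bn0 : b (z n) (z i0) != 0.
    apply: hb' => //; rewrite ?inE ?eqxx ?hns ?orbT //.
    by apply: contraNneq ns => <-.
  by field; rewrite bt0 tn bn0.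
rewrite !big_cons eqxx /= [X in _ = _ + (X + _)](_ : _ = c x (z t) * b x (z i0) *
   (c (z t) (z i0) / b (z t) (z i0) * \prod_(i <- s) (b x (z i) / b (z t) (z i)))); last first.
  rewrite -!mulrA; do 4!congr (_ * _).
  rewrite big_seq_cond [RHS]big_seq; apply: eq_bigl => i.
  by case: eqP => [->|]; rewrite ?(negbTE ts) ?andbT.
(* In the terms [n] of [s], [bc_exchange] removes the factor at [t]. The corrections add up to minus
   the sum that [E] produces. *)
rewrite E [X in _ = _ + (_ + X)](_ : _ =
   \sum_(n <- s) c x (z n) * (b x (z i0) * c (z n) (z i0) / b (z n) (z i0)) *
      \prod_(i <- s | i != n) (b x (z i) / b (z n) (z i)) -
   c x (z t) * b x (z i0) * 
    \sum_(n <- s) b x (z n) * (c (z t) (z n) / b (z t) (z n)) *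
      (c (z n) (z i0) / b (z n) (z i0)) *
      \prod_(i <- s | i != n) (b x (z i) / b (z n) (z i))); last first.
  rewrite mulr_sumr -sumrB; apply: eq_big_seq => n hns; have [nt' tn] := bt _ hns.
  rewrite big_cons; have -> : t != n by apply: contraNneq ts => ->.
  move: (bc_exchange x (z n) (z t) hunit hYB nt' tn) => H.
  transitivity (c x (z n) * (b x (z t) / b (z n) (z t)) * 
     (b x (z i0) * c (z n) (z i0) / b (z n) (z i0)) *
     \prod_(j <- s | j != n) (b x (z j) / b (z n) (z j))); first by ring.
  by rewrite H; ring.
(* The exchange in the leading product leaves a correction that cancels the first term of [E]; what
   remains is the induction hypothesis at [x]. *)
rewrite mulrA bc_exchange // {1}(IH x) //.
by ring.
Qed.
End Consequences.

(** * Monodromy matrices *)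

Section Monodromy.
Context {Lambda : Type} {K : fieldType} (w : weights Lambda K).

(* The auxiliary space [a] is itself one of the sites: the monodromy matrix is
   the case [a = None] over [option I], and X_n the case [a = n] over [I]. *)
Definition row_monodromy {I : finType} (z : I -> Lambda) (a : I) (s : seq I) (x : Lambda) :
    TensorEnd K I :=
  \prod_(i <- rev s) Rop w a i x (z i).

Context {I : finType} (z : I -> Lambda).
Implicit Types (a i n : I) (s : seq I) (A : TensorEnd K I).
Local Notation Mon := (row_monodromy z).

Lemma Mon_nil a x : Mon a [::] x = 1%:M.
Proof. by rewrite /row_monodromy big_nil. Qed.

Lemma Mon_cons a i s x : Mon a (i :: s) x = Mon a s x *m Rop w a i x (z i).
Proof. by rewrite /row_monodromy rev_cons -cats1 big_cat big_seq1. Qed.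

Lemma Mon_cat a s1 s2 x : Mon a (s1 ++ s2) x = Mon a s2 x *m Mon a s1 x.
Proof. by rewrite /row_monodromy rev_cat big_cat. Qed.

Lemma Mon_comm A a s x :
  (forall i, i \in s -> A *m Rop w a i x (z i) = Rop w a i x (z i) *m A) ->
  A *m Mon a s x = Mon a s x *m A.
Proof.
elim: s => [|i s IH] H; first by rewrite Mon_nil mulmx1 mul1mx.
rewrite Mon_cons mulmxA IH; last by move=> k ks; apply: H; rewrite inE ks orbT.
by rewrite -!mulmxA H // inE eqxx.
Qed.

(** Induction on [s]: the new site [i] uses the Yang-Baxter equation on [a], [n], [i], while its
    R-matrix with one row commutes with the rest of the other row, the pairs of sites being
    disjoint. *)
Lemma RTT a n s x y : yang_baxter w -> a != n -> a \notin s -> n \notin s -> uniq s ->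
  Rop w a n x y *m Mon a s x *m Mon n s y = Mon n s y *m Mon a s x *m Rop w a n x y.
Proof.
move=> hYB an; elim: s => [|i s IH]; first by rewrite !Mon_nil !mulmx1 !mul1mx.
rewrite !inE !negb_or => /andP[ai as_] /andP[ni ns] /= /andP[is_ us].
rewrite !Mon_cons.
have H1 : Rop w a i x (z i) *m Mon n s y = Mon n s y *m Rop w a i x (z i).
  apply: Mon_comm => k ks; have ik : i != k by apply: contraNneq is_ => ->.
  have ak : a != k by apply: contraNneq as_ => ->.
  have nk : n != k by apply: contraNneq ns => ->.
  by apply: act_onC => //; rewrite eq_sym.
have H2 : Rop w n i y (z i) *m Mon a s x = Mon a s x *m Rop w n i y (z i).
  apply: Mon_comm => k ks; have ik : i != k by apply: contraNneq is_ => ->.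
  have ak : a != k by apply: contraNneq as_ => ->.
  have nk : n != k by apply: contraNneq ns => ->.
  by apply: act_onC => //; rewrite eq_sym.
rewrite -!mulmxA (mulmxA (Rop w a i _ _)) H1 !mulmxA IH //.
rewrite -!mulmxA [Rop w a n _ _ *m _]mulmxA Rop_YBE //.
by rewrite -!mulmxA (mulmxA (Mon a s x)) -H2 -!mulmxA.
Qed.

(** The factor of [n] stands to the left of those of [s1]. [RTT] with [y := z n] brings it to their
    right, and the factors of [s2] commute with X_n. *)
Lemma Mon_intertwine a n s1 s2 x : yang_baxter w ->
  a != n -> a \notin s1 -> uniq (s1 ++ n :: s2) -> a \notin s2 ->
  Mon a (s1 ++ n :: s2) x *m Mon n s1 (z n) = Mon n s1 (z n) *m Mon a (n :: s1 ++ s2) x.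
Proof.
move=> hYB an as1; rewrite cat_uniq /= negb_or.
move=> /and3P[us1 /andP[ns1 /hasPn dis] /andP[ns2 us2]] as2.
suff C : Mon a s2 x *m Mon n s1 (z n) = Mon n s1 (z n) *m Mon a s2 x.
  rewrite Mon_cat !Mon_cons Mon_cat -!mulmxA [Rop _ _ _ _ _ *m _]mulmxA RTT //.
  by rewrite !mulmxA C.
apply/esym/Mon_comm => i is2; apply/esym/Mon_comm => k ks1.
have ki : k != i by apply: contraNneq (dis _ is2) => <-.
have ni : n != i by apply: contraNneq ns2 => ->.
have ak : a != k by apply: contraNneq as1 => ->.
have ai : a != i by apply: contraNneq as2 => ->.
have nk : n != k by apply: contraNneq ns1 => ->.
by apply: act_onC; rewrite // eq_sym.
Qed.

Lemma Mon_out a s x (y : config I) : a \notin s -> y a = ord0 ->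
  {in s, forall i, y i = ord0} -> Mon a s x *m ket y = ket y.
Proof.
elim: s => [|i s IH]; first by rewrite Mon_nil mul1mx.
rewrite inE negb_or => /andP[ai as_] ya ys.
rewrite Mon_cons -mulmxA Rop_ket00 // ?IH //; first by move=> k ks; apply: ys; rewrite inE ks orbT.
by apply: ys; rewrite inE eqxx.
Qed.

(** The R-matrix of [i] acts first. If it moves the [e2] from [a] to [i], the later factors see only
    [e1] and act trivially. *)
Lemma Mon_one_cons a i s x (y : config I) : a != i -> a \notin s -> i \notin s ->
  y a = ord0 -> y i = ord0 -> {in s, forall k, y k = ord0} ->
  Mon a (i :: s) x *m ket (upd y a ord_max) =
  b_minus w x (z i) *: (Mon a s x *m ket (upd y a ord_max)) +
  c_plus w x (z i) *: ket (upd y i ord_max).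
Proof.
move=> ai as_ is_ ya yi ys; rewrite Mon_cons -mulmxA Rop_one_l // mulmxDr -!scalemxAr.
congr (_ + _ *: _); apply: Mon_out => //; first by rewrite updE (negbTE ai).
by move=> k ks; rewrite updE ys //; case: eqP => // e; rewrite -e ks in is_.
Qed.

Lemma bra_Mon a s x (y : config I) : a \notin s -> y a = ord_max ->
  {in s, forall i, y i = ord_max} ->
  bra y *m Mon a s x = (\prod_(i <- s) a_minus w x (z i)) *: (bra y : 'rV[K]_#|config I|).
Proof.
move=> as_ ya; elim: s as_ => [|i s IH]; first by rewrite Mon_nil mulmx1 big_nil scale1r.
rewrite inE negb_or => /andP[ai as_] ys.
rewrite Mon_cons mulmxA IH //; last by move=> k ks; apply: ys; rewrite inE ks orbT.
rewrite -scalemxAl bra_Rop //; last by apply: ys; rewrite inE eqxx.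
by rewrite scalerA big_cons mulrC.
Qed.

(** The condition that site [n] carries [e2], in the form of an operator that can be moved through
    products of B. *)
Definition proj_e2 n : TensorEnd K I := diag_mx (\row_p (conf p n == ord_max)%:R).

Lemma projE n p q : proj_e2 n p q = ((p == q) && (conf p n == ord_max))%:R.
Proof. by rewrite !mxE; case: (p == q); rewrite ?mulr1n ?mulr0n. Qed.

Lemma proj_ket n (y : config I) : proj_e2 n *m ket y = (y n == ord_max)%:R *: ket y.
Proof.
apply/matrixP => p q; rewrite ord1 /ket -colE mxE projE !mxE eqxx andbT.
by case: (p =P enum_rank y) => [->|]; rewrite ?conf_rank ?mulr1 ?mulr0.
Qed.

Lemma proj_Rop n i j x1 x2 : n != i -> n != j ->
  proj_e2 n *m Rop w i j x1 x2 = Rop w i j x1 x2 *m proj_e2 n.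
Proof.
move=> ni nj; rewrite /proj_e2 mul_diag_mx mul_mx_diag; apply/matrixP => p q.
rewrite !mxE /=; case: (boolP [forall _, _]) => [/forallP /(_ n)|_].
  by rewrite ni nj /= => /eqP ->; rewrite mulrC.
by rewrite mulr0n mulr0 mul0r.
Qed.

Lemma proj_Mon n a s x : n != a -> n \notin s -> proj_e2 n *m Mon a s x = Mon a s x *m proj_e2 n.
Proof.
move=> na ns; apply: Mon_comm => i is_; apply: proj_Rop => //.
by apply: contraNneq ns => ->.
Qed.

End Monodromy.

(** * Block decomposition with respect to the auxiliary space *)

Section Blocks.
Context {Lambda : Type} {K : fieldType} (w : weights Lambda K) {I : finType}.
Implicit Types (A B : TensorEnd K (option I)) (x y : config I) (s t : 'I_2).

Lemma with_aux_inj s t x y : (with_aux s x == with_aux t y) = (s == t) && (x == y).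
Proof.
apply/eqP/andP => [/ffunP e|[/eqP-> /eqP->] //]; split; apply/eqP.
  by move: (e None); rewrite !ffunE.
by apply/ffunP => i; move: (e (Some i)); rewrite !ffunE.
Qed.

Lemma with_auxN s x : with_aux s x None = s. Proof. by rewrite ffunE. Qed.
Lemma with_auxS s x i : with_aux s x (Some i) = x i. Proof. by rewrite ffunE. Qed.

Lemma upd_auxN s t x : upd (with_aux s x) None t = with_aux t x.
Proof. by apply/ffunP => -[k|]; rewrite !ffunE. Qed.

Lemma upd_auxS s t x i : upd (with_aux s x) (Some i) t = with_aux s (upd x i t).
Proof. by apply/ffunP => -[k|]; rewrite !ffunE. Qed.

Lemma sum_with_aux (V : nmodType) (F : 'I_#|config (option I)| -> V) :
  \sum_p F p = \sum_s \sum_p F (enum_rank (with_aux s (@conf I p))).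
Proof.
transitivity (\sum_s \sum_y F (enum_rank (with_aux s y))); last first.
  by apply: eq_bigr => s _; rewrite sum_conf; apply: eq_bigr => y _; rewrite conf_rank.
rewrite sum_conf.
rewrite pair_big /= (reindex (fun sx => with_aux sx.1 sx.2)) //.
exists (fun x : config (option I) => (x None, [ffun i => x (Some i)])) => [[s x]|x] _ /=.
  by rewrite with_auxN; congr (_, _); apply/ffunP => i; rewrite !ffunE.
by apply/ffunP => -[i|]; rewrite !ffunE.
Qed.

Lemma aux_entryM s t A B :
  aux_entry s t (A *m B) = \sum_u aux_entry s u A *m aux_entry u t B.
Proof.
apply/matrixP => p q; rewrite summxE !mxE sum_with_aux; apply: eq_bigr => u _.
by rewrite mxE; apply: eq_bigr => r _; rewrite !mxE.
Qed.

(* [A] acts as [A'] on the quantum sites and trivially on the auxiliary space. *)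
Definition lifts A (A' : TensorEnd K I) := forall s t, aux_entry s t A = (s == t)%:R *: A'.

Lemma aux_liftsl A (A' : TensorEnd K I) s t B : lifts A A' ->
  aux_entry s t (A *m B) = A' *m aux_entry s t B.
Proof.
move=> AA; rewrite aux_entryM (bigD1 s) //= AA eqxx scale1r big1 ?addr0 // => u us.
by rewrite AA eq_sym (negbTE us) scale0r mul0mx.
Qed.

Lemma aux_liftsr A (A' : TensorEnd K I) s t B : lifts A A' ->
  aux_entry s t (B *m A) = aux_entry s t B *m A'.
Proof.
move=> AA; rewrite aux_entryM (bigD1 t) //= AA eqxx scale1r big1 ?addr0 // => u us.
by rewrite AA (negbTE us) scale0r mulmx0.
Qed.

Lemma lifts1 : lifts 1%:M 1%:M.
Proof.
move=> s t; apply/matrixP => p q; rewrite !mxE (inj_eq enum_rank_inj) with_aux_inj.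
by rewrite (inj_eq enum_val_inj); case: eqP; rewrite ?mul1r ?mul0r.
Qed.

Lemma liftsM A (A' : TensorEnd K I) B (B' : TensorEnd K I) :
  lifts A A' -> lifts B B' -> lifts (A *m B) (A' *m B').
Proof. by move=> AA BB s t; rewrite (aux_liftsl _ _ _ _ _ AA) BB -scalemxAr. Qed.

Lemma lifts_Rop (i j : I) (x1 x2 : Lambda) :
  lifts (Rop w (Some i) (Some j) x1 x2) (Rop w i j x1 x2).
Proof.
move=> s t; apply/matrixP => p q; rewrite !mxE /= !conf_rank !with_auxS.
case: (eqVneq s t) => [->|st]; last first.
  rewrite mul0r; case: (boolP [forall _, _]) => // /forallP /(_ None).
  by rewrite !with_auxN (negbTE st).
rewrite mul1r; congr (_ *+ _); congr nat_of_bool.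
apply/forallP/forallP => [H k|H [k|]]; last by rewrite !with_auxN eqxx implybT.
  by move: (H (Some k)); rewrite !with_auxS.
by move: (H k); rewrite !with_auxS.
Qed.

(** X_n never touches [None], so it passes in and out of [aux_entry]. This brings the intertwining
    relation down to the B operators. *)
Lemma lifts_Mon (z : I -> Lambda) zo n (l : seq I) (x : Lambda) : (forall i, zo (Some i) = z i) ->
  lifts (row_monodromy w zo (Some n) (map Some l) x) (row_monodromy w z n l x).
Proof.
move=> zE; elim: l => [|i l IH] /=; first by rewrite !Mon_nil; apply: lifts1.
by rewrite !Mon_cons zE; apply: liftsM => //; apply: lifts_Rop.
Qed.

Lemma lifts_proj (n : I) : lifts (proj_e2 (Some n)) (proj_e2 n).
Proof.
move=> s t; apply/matrixP => p q; rewrite mxE projE [RHS]mxE projE conf_rank with_auxS.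
rewrite (inj_eq enum_rank_inj) with_aux_inj (inj_eq enum_val_inj).
by case: (s == t); rewrite ?mul1r ?mul0r.
Qed.

Lemma aux_entry_ket s t A y p :
  (aux_entry s t A *m ket y) p 0 =
  (A *m ket (with_aux t y)) (enum_rank (with_aux s (conf p))) 0.
Proof. by rewrite /ket -!colE !mxE conf_rank. Qed.

End Blocks.

(** * The recursion on the number of sites *)

Section Recursion.
Context {Lambda : Type} {K : fieldType} (w : weights Lambda K).
Context {I : finType} (z : I -> Lambda).
Implicit Types (i n : I) (s : seq I) (x : Lambda) (y : config I).
Local Notation a := (a_minus w).
Local Notation b := (b_minus w).
Local Notation c := (c_plus w).
Local Notation T s x := (row_monodromy w (oapp z x) None (map Some s) x).
Local Notation X n s := (row_monodromy w z n s (z n)).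

(** Only the sites of [s] interact, but the operator acts on the space over all of [I], so removing
    a site does not change the space. The default [x] of [oapp] at [None] is never read. *)
Definition Bsites s x : TensorEnd K I := aux_entry ord0 ord_max (T s x).

Lemma None_notin s : None \notin map Some s.
Proof. by apply/mapP => -[]. Qed.

Lemma Bsites_intertwine n s1 s2 x : yang_baxter w -> uniq (s1 ++ n :: s2) ->
  Bsites (s1 ++ n :: s2) x *m X n s1 = X n s1 *m Bsites (n :: s1 ++ s2) x.
Proof.
move=> hYB us; rewrite /Bsites.
have L := @lifts_Mon _ _ w I z (oapp z x) n s1 (z n) (fun=> erefl).
rewrite -(aux_liftsr _ _ _ _ _ L) -(aux_liftsl _ _ _ _ _ L) map_cat /= map_cat.
rewrite -(Mon_intertwine w (oapp z x) None (Some n)) ?None_notin //.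
by rewrite -[_ :: map _ _]/(map Some (n :: s2)) -map_cat map_inj_uniq // => ? ? [].
Qed.

(** The auxiliary space enters in [e2]. If site [n] is also in [e2], the first factor leaves both
    unchanged with weight [a_minus], so only the block [u = ord_max] survives. *)
Lemma Bsites_proj n s x : n \notin s ->
  Bsites (n :: s) x *m proj_e2 n = a x (z n) *: (Bsites s x *m proj_e2 n).
Proof.
move=> ns; rewrite /Bsites /= Mon_cons.
rewrite -(aux_liftsr _ _ _ _ _ (lifts_proj n)) -mulmxA aux_entryM.
have E u : aux_entry u ord_max (Rop w None (Some n) x (z n) *m proj_e2 (Some n)) =
    (u == ord_max)%:R *: (a x (z n) *: (proj_e2 n : TensorEnd K I)).
  apply: ket_ext => y; apply/matrixP => p q; rewrite ord1 aux_entry_ket.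
  rewrite -mulmxA proj_ket with_auxS -scalemxAr -!scalemxAl proj_ket.
  case: eqP => [yn|_]; last by rewrite !(scale0r, scaler0) !mxE.
  rewrite !scale1r Rop_ket11 ?with_auxN ?with_auxS //.
  rewrite !mxE (inj_eq enum_rank_inj) with_aux_inj !eqxx andbT.
  rewrite -{2}(enum_valK p) (inj_eq enum_rank_inj) /conf.
  by rewrite andbT; do 2 case: (_ == _); rewrite ?mul1r ?mul0r ?mulr0.
rewrite (bigD1 ord_max) //= big1 ?addr0 => [|u /negbTE nu].
  by rewrite /= E eqxx scale1r -scalemxAr.
by rewrite /= E nu scale0r mulmx0.
Qed.

Lemma Bsites_projC n s x : n \notin s -> proj_e2 n *m Bsites s x = Bsites s x *m proj_e2 n.
Proof.
move=> ns; rewrite /Bsites -(aux_liftsr _ _ _ _ _ (lifts_proj n)).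
rewrite -(aux_liftsl _ _ _ _ _ (lifts_proj n)) proj_Mon //.
by apply: contra ns => /mapP[k ks [->]].
Qed.

Lemma Bsites_nil x : Bsites [::] x = 0.
Proof. by rewrite /Bsites Mon_nil lifts1 scale0r. Qed.

(** The auxiliary space enters in [e2] and must leave in [e1]: either the [e2] is deposited at [i],
    or it goes on to the sites of [s]. *)
Lemma Bsites_cons_ket i s x y : i \notin s -> y i = ord0 -> {in s, forall k, y k = ord0} ->
  Bsites (i :: s) x *m ket y =
  b x (z i) *: (Bsites s x *m ket y) + c x (z i) *: ket (upd y i ord_max).
Proof.
move=> is_ yi ys; apply/matrixP => p q; rewrite ord1 [RHS]mxE [in RHS]mxE.
rewrite !aux_entry_ket -(upd_auxN ord0) /= Mon_one_cons ?None_notin ?with_auxN ?with_auxS //;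
  first last.
- by move=> _ /mapP[k ks ->]; rewrite with_auxS ys.
- by apply: contra is_ => /mapP[k ks [->]].
rewrite mxE [in LHS]mxE; congr (_ + _); rewrite mxE [RHS]mxE; congr (_ * _).
rewrite upd_auxS !mxE eqxx !andbT (inj_eq enum_rank_inj) with_aux_inj eqxx /=.
by rewrite -{2}(enum_valK p) (inj_eq enum_rank_inj).
Qed.

Local Notation before n s := (take (index n s) s).

(** Induction on [s]. Putting a site [i] in front multiplies each X_n on the right by an R-matrix of
    [n] and [i], which creates extra multiples of the state with [e2] at [i]; [bc_partial_fractions]
    sums their coefficients. *)
Lemma Bsites_ket s x y : unitarity w -> yang_baxter w -> uniq s ->
  {in s &, forall i j, i != j -> b (z i) (z j) != 0} ->
  {in s, forall k, y k = ord0} ->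
  Bsites s x *m ket y = \sum_(n <- s)
    (c x (z n) * \prod_(i <- s | i != n) (b x (z i) / b (z n) (z i))) *:
      (X n (before n s) *m ket (upd y n ord_max)).
Proof.
move=> hunit hYB; elim: s => [|i s IH] us hb ys.
  by rewrite Bsites_nil mul0mx big_nil.
move: (us) => /= /andP[is_ us'].
have sub : {subset s <= i :: s} by move=> k; rewrite inE orbC => ->.
have yi : y i = ord0 by apply: ys; rewrite inE eqxx.
have ys' : {in s, forall k, y k = ord0} by move=> k /sub; apply: ys.
rewrite Bsites_cons_ket // IH //; last by move=> k l /sub ks /sub ls; apply: hb.
rewrite {1}(bc_partial_fractions z s i x) // scalerDl addrCA big_cons.
have notk n : n \in s -> (i == n) = false.
  by move=> ns; apply/eqP => e; rewrite e ns in is_.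
congr (_ + _).
  (* For [n = i] no site precedes [n], so X_n is the identity. *)
  rewrite /= eqxx /= Mon_nil mul1mx big_cons eqxx; congr (_ * _ *: _).
  rewrite big_seq [RHS]big_seq_cond; apply: eq_bigl => k.
  by case ks: (k \in s) => //=; rewrite eq_sym notk.
rewrite scaler_suml scaler_sumr -big_split; apply: eq_big_seq => n ns /=.
have ni : n != i by rewrite eq_sym notk.
have nz : b (z n) (z i) != 0 by apply: hb; rewrite ?inE ?eqxx ?ns ?orbT.
rewrite big_cons notk //= Mon_one_cons //; first last.
- by move=> k /mem_take; apply: ys'.
- exact: ys'.
- by apply: contra is_ => /mem_take.
- by rewrite in_take_leq ?index_size ?ltnn // ltnW // index_mem.
rewrite scalerDr !scalerA; congr (_ *: _ + _ *: _); move: (\prod_(j <- s | _) _) => p; by field.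
Qed.

Definition fill s (t : 'I_2) y : config I := [ffun i => if i \in s then t else y i].

Lemma fill_in s t y i : i \in s -> fill s t y i = t.
Proof. by rewrite ffunE => ->. Qed.

Lemma fill_rem n s t y : uniq s -> n \in s ->
  fill (rem n s) t (upd y n ord_max) = upd (fill s t y) n ord_max.
Proof.
move=> us ns; apply/ffunP => i; rewrite !ffunE mem_rem_uniq // inE.
by case: eqP => [->|] /=.
Qed.

(** Off [s] both boundary vectors agree with [y], so the sites already removed are spectators. *)
Definition Zsites s y (xs : seq Lambda) : K :=
  (bra (fill s ord_max y) *m \prod_(x <- xs) Bsites s x *m ket (fill s ord0 y)) 0 0.

Lemma prod_Bsites_intertwine n s1 s2 (xs : seq Lambda) :
  yang_baxter w -> uniq (s1 ++ n :: s2) ->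
  (\prod_(x <- xs) Bsites (s1 ++ n :: s2) x) *m X n s1 =
  X n s1 *m \prod_(x <- xs) Bsites (n :: s1 ++ s2) x.
Proof.
move=> hYB us; elim: xs => [|x xs IH]; first by rewrite !big_nil mul1mx mulmx1.
by rewrite !big_cons -!mulmxE -mulmxA IH !mulmxA Bsites_intertwine.
Qed.

Lemma prod_Bsites_proj n s (xs : seq Lambda) : n \notin s ->
  (\prod_(x <- xs) Bsites (n :: s) x) *m proj_e2 n =
  (\prod_(x <- xs) a x (z n)) *: ((\prod_(x <- xs) Bsites s x) *m proj_e2 n).
Proof.
move=> ns; have PC (us : seq Lambda) :
    (\prod_(x <- us) Bsites s x) *m proj_e2 n = proj_e2 n *m \prod_(x <- us) Bsites s x.
  elim: us => [|u us IH]; first by rewrite !big_nil mul1mx mulmx1.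
  by rewrite !big_cons -!mulmxE -mulmxA IH !mulmxA Bsites_projC.
elim: xs => [|x xs IH]; first by rewrite !big_nil scale1r.
rewrite !big_cons -!mulmxE -mulmxA IH -scalemxAr PC mulmxA Bsites_proj //.
by rewrite -scalemxAl scalerA mulrC -!mulmxA PC.
Qed.

(** The last operator acts first and is expanded by [Bsites_ket]. X_n then moves left through the
    other operators onto the bra, and each of these loses the site [n] at the cost of a factor
    [a]. *)
Lemma Zsites_rcons s y (xs : seq Lambda) x : unitarity w -> yang_baxter w -> uniq s ->
  {in s &, forall i j, i != j -> b (z i) (z j) != 0} ->
  Zsites s y (rcons xs x) = \sum_(n <- s)
    c x (z n) * \prod_(i <- s | i != n) (b x (z i) / b (z n) (z i)) *
    \prod_(i <- before n s) a (z n) (z i) * \prod_(u <- xs) a u (z n) *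
    Zsites (rem n s) (upd y n ord_max) xs.
Proof.
move=> hunit hYB us hb; rewrite /Zsites.
have -> : \prod_(u <- rcons xs x) Bsites s u = (\prod_(u <- xs) Bsites s u) *m Bsites s x.
  by rewrite -cats1 big_cat big_seq1.
rewrite -mulmxA -mulmxA.
rewrite Bsites_ket //; last by move=> k; apply: fill_in.
rewrite !mulmx_sumr summxE; apply: eq_big_seq => n ns.
have [s1 [s2 [es e1 e2]]] : exists s1 s2,
    [/\ s = s1 ++ n :: s2, before n s = s1 & rem n s = s1 ++ s2].
  exists (before n s), (drop (index n s).+1 s); split => //.
    by rewrite -{1}(cat_take_drop (index n s) s) (drop_nth n) ?index_mem // nth_index.
  exact: remE.
have us1 : uniq (n :: s1 ++ s2) by rewrite -e2 -(perm_uniq (perm_to_rem ns)).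
move: (us1) => /= /andP[nss _].
have := prod_Bsites_intertwine n s1 s2 xs hYB; rewrite -es -e2 => /(_ us) PX.
have ns1 : n \notin s1 by move: nss; rewrite mem_cat negb_or => /andP[].
rewrite -e2 in nss.
have k2 : upd (fill s ord0 y) n ord_max n = ord_max by rewrite updE eqxx.
rewrite -!scalemxAr mxE -!mulrA; congr (_ * (_ * _)).
rewrite e1 !fill_rem // [upd (fill s ord_max y) _ _]upd_id ?fill_in //.
(* The projector fixes this ket; it is inserted so that [prod_Bsites_proj] applies once X_n has
   passed. *)
rewrite -[ket _](_ : proj_e2 n *m ket (upd (fill s ord0 y) n ord_max) = _); last first.
  by rewrite proj_ket k2 eqxx scale1r.
rewrite (mulmxA (\prod_(_ <- _) _)) PX !mulmxA bra_Mon ?fill_in //; last first.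
  by move=> i is1; rewrite fill_in // es mem_cat is1.
rewrite -!scalemxAl mxE; congr (_ * _).
rewrite -[in LHS](mulmxA (bra _)) (prod_Bsites_proj n (rem n s) xs nss).
by rewrite -scalemxAr -scalemxAl mxE !mulmxA.
Qed.

End Recursion.

(** * The sum over permutations *)

(** A permutation is determined by the image [i] of the last point and the permutation induced on
    the others; injectivity and a count give the bijection. *)
Lemma sum_lift_perm (V : nmodType) n (F : 'S_n.+1 -> V) :
  \sum_s F s = \sum_(i < n.+1) \sum_(t : 'S_n) F (lift_perm ord_max i t).
Proof.
rewrite pair_big /= (reindex (fun it => lift_perm ord_max it.1 it.2)) //.
apply: onW_bij; apply: inj_card_bij => [[i s] [j t] /= e|].
  have ij : i = j by rewrite -(lift_perm_id ord_max i s) e lift_perm_id.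
  rewrite -ij in e *; congr (_, _); apply/permP => k.
  by apply: (@lift_inj _ i); rewrite -!(lift_perm_lift ord_max) e.
by rewrite card_prod card_ord !card_Sn factS.
Qed.

Lemma sorted_enum_ord n : sorted (fun i j : 'I_n => (i < j)%N) (enum 'I_n).
Proof.
have := iota_ltn_sorted 0 n; rewrite -val_enum_ord sorted_map.
exact: sub_sorted.
Qed.

(** Both lists are strictly increasing and have the same elements. *)
Lemma rem_enum_ord n (i : 'I_n.+1) :
  rem i (enum 'I_n.+1) = [seq lift i k | k <- enum 'I_n].
Proof.
rewrite rem_filter ?enum_uniq //.
apply: (@irr_sorted_eq _ (fun i j : 'I_n.+1 => (i < j)%N)).
- by move=> ? ? ?; apply: ltn_trans.
- by move=> ?; apply: ltnn.
- apply: sorted_filter (sorted_enum_ord _); by move=> ? ? ?; apply: ltn_trans.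
- apply: homo_sorted (sorted_enum_ord _) => j k /= jk.
  by rewrite /bump; do 2 case: leqP => //=; lia.
move=> k; rewrite mem_filter mem_enum inE andbT /=.
case: (unliftP i k) => [j|] ->; first by rewrite eq_sym neq_lift map_f // mem_enum.
rewrite eqxx; apply/esym/negbTE/mapP => -[j _ /eqP].
by rewrite (negbTE (neq_lift _ _)).
Qed.

Lemma take_enum_ord n (i : 'I_n) :
  take i (enum 'I_n) = [seq k : 'I_n <- enum 'I_n | (k < i)%N].
Proof.
apply: (inj_map val_inj); rewrite map_take val_enum_ord.
transitivity [seq k <- map val (enum 'I_n) | (k < i)%N]; last by rewrite filter_map.
rewrite val_enum_ord.
rewrite (filter_iota_ltn 0) ?take_iota; last exact: ltnW.
by rewrite (minn_idPl _) // ltnW.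
Qed.

Lemma index_enum_enum (T : finType) : index_enum T = enum T.
Proof. by rewrite [index_enum T]unlock -enumT. Qed.

Lemma rem_map (T T' : eqType) (f : T -> T') x (s : seq T) : injective f ->
  rem (f x) (map f s) = map f (rem x s).
Proof.
by move=> f_inj; elim: s => //= y s ->; rewrite (inj_eq f_inj); case: (y == x).
Qed.

Lemma widen_lift n (k : 'I_n) : widen_ord (leqnSn n) k = lift ord_max k.
Proof. by apply: val_inj; rewrite /= /bump leqNgt ltn_ord. Qed.

(** The row [j = ord_max] is empty, and every other row ends with [k = ord_max]. *)
Lemma prod_ord_lt_recr (R : comNzRingType) n (F : 'I_n.+1 -> 'I_n.+1 -> R) :
  \prod_(j < n.+1) \prod_(k < n.+1 | (j < k)%N) F j k =
  (\prod_(j < n) \prod_(k < n | (j < k)%N) F (lift ord_max j) (lift ord_max k)) *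
  \prod_(j < n) F (lift ord_max j) ord_max.
Proof.
rewrite big_ord_recr /= [X in _ * X]big_pred0 ?mulr1; last first.
  by move=> k; rewrite ltnNge -ltnS ltn_ord.
rewrite -big_split; apply: eq_bigr => j _ /=.
rewrite big_mkcond big_ord_recr /= ltn_ord widen_lift; congr (_ * _).
rewrite [RHS]big_mkcond; apply: eq_bigr => k _.
by rewrite widen_lift.
Qed.

Lemma prod_lift (R : comNzRingType) n (i : 'I_n.+1) (F : 'I_n.+1 -> R) :
  \prod_(k | k != i) F k = \prod_(k < n) F (lift i k).
Proof.
rewrite index_enum_enum -big_filter -(rem_filter i) ?enum_uniq //.
by rewrite rem_enum_ord big_map index_enum_enum.
Qed.

(** * The closed formula for the partition function *)

Section PartitionFunction.
Context {Lambda : Type} {K : fieldType} (w : weights Lambda K).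
Local Notation a := (a_minus w).
Local Notation b := (b_minus w).
Local Notation c := (c_plus w).

Lemma tensor_ket (I : finType) (t : 'I_2) :
  tensor (fun=> delta_mx t 0) = ket [ffun=> t] :> TensorSpace K I.
Proof.
apply/colP => p; rewrite !mxE eqxx andbT.
case: (p =P enum_rank [ffun=> t]) => [->|ne].
  by rewrite big1 // => i _; rewrite conf_rank ffunE mxE !eqxx.
have [i ni] : exists i, conf p i != t.
  apply/existsP; apply: contraT; rewrite negb_exists => /forallP H.
  case: ne; rewrite -(enum_valK p); congr enum_rank; apply/ffunP => i.
  by rewrite ffunE; apply/eqP; rewrite -[_ == _]negbK H.
by rewrite (bigD1 i) //= mxE (negbTE ni) mul0r.
Qed.

Lemma bra1E M : bra1 K M = bra [ffun=> ord_max].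
Proof. by rewrite /bra1 tensor_ket trmx_delta. Qed.

Lemma BopE M (z : 'I_M -> Lambda) x : Bop w z x = Bsites w z (enum 'I_M) x.
Proof.
congr aux_entry; rewrite /monodromy /row_monodromy -map_rev big_map.
have -> : rev (enum 'I_M) = [seq rev_ord k | k <- enum 'I_M].
  apply: (inj_map val_inj); rewrite map_rev val_enum_ord -map_comp.
  apply: (@eq_from_nth _ 0%N) => [|i]; rewrite size_rev size_iota.
    by rewrite size_map size_enum_ord.
  move=> iM.
  rewrite nth_rev ?size_iota // nth_iota; last by lia.
  by rewrite (nth_map (Ordinal iM)) ?size_enum_ord //= nth_enum_ord.
by rewrite big_map index_enum_enum.
Qed.

(** The list contains every site, so the background [y] is entirely overwritten and can be
    arbitrary. *)
Lemma ZBE M (mu z : 'I_M -> Lambda) y :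
  ZB w mu z = Zsites w z (enum 'I_M) y [seq mu k | k <- enum 'I_M].
Proof.
have fE t : fill (enum 'I_M) t y = [ffun=> t].
  by apply/ffunP => i; rewrite !ffunE mem_enum.
rewrite /ZB /Zsites !fE bra1E /ket0 tensor_ket; congr ((_ *m _ *m _) _ _).
rewrite big_map index_enum_enum.
by apply: eq_bigr => k _; apply: BopE.
Qed.

(** The remaining sites are the image of an increasing [g]. Removing the site [g i] replaces [g] by
    [g \o lift i], again increasing, and sets [e2] in the background; hence the induction on [m] is
    over all [g], [mu] and [y]. *)
Lemma Zsites_perm M (z : 'I_M -> Lambda) m (g : 'I_m -> 'I_M) (mu : 'I_m -> Lambda) y :
  unitarity w -> yang_baxter w ->
  {homo g : j k / (j < k)%N} ->
  (forall i j : 'I_M, i != j -> b (z i) (z j) != 0) ->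
  Zsites w z [seq g k | k <- enum 'I_m] y [seq mu k | k <- enum 'I_m] =
  \sum_(s : 'S_m)
    (\prod_(i < m) c (mu i) (z (g (s i)))) *
    \prod_(j < m) \prod_(k < m | (j < k)%N)
      ((b (mu k) (z (g (s j))) * a (mu j) (z (g (s k)))) /
       (b (z (g (s k))) (z (g (s j))) * theta w z (g (s j)) (g (s k)))).
Proof.
move=> hunit hYB gm hb; elim: m g mu y gm => [|m IH] g mu y gm.
  have -> : enum 'I_0 = [::] by apply: size0nil; rewrite size_enum_ord.
  rewrite /Zsites big_nil mulmx1 bra_ket.
  have e t : fill [::] t y = y by apply/ffunP => i; rewrite ffunE.
  rewrite !e eqxx mxE eqxx.
  under eq_bigr do rewrite !big_ord0 mulr1.
  by rewrite sumr_const card_Sn.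
have g_inj : injective g.
  move=> i j gij; apply: val_inj; case: (ltngtP i j) => // /gm; by rewrite gij ltnn.
rewrite [in X in Zsites _ _ _ _ X]enum_ordSr map_rcons -map_comp Zsites_rcons //; first last.
- by move=> i j _ _; apply: hb.
- by rewrite map_inj_uniq ?enum_uniq.
(* The removed site is [g i], where [i] is the image of the last index under the permutation. *)
rewrite sum_lift_perm big_map big_enum; apply: eq_bigr => i _ /=.
have muE : [seq ([eta mu] \o widen_ord (leqnSn m)) k | k <- enum 'I_m] =
    [seq (mu \o lift ord_max) k | k <- enum 'I_m].
  by apply: eq_map => k /=; rewrite widen_lift.
rewrite muE rem_map // rem_enum_ord -(map_comp g (lift i)) IH; last first.
  by move=> j k jk; apply: gm; rewrite /= /bump; do 2 case: leqP => //=; lia.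
rewrite index_map // index_enum_ord -map_take take_enum_ord !big_map big_filter.
rewrite -!index_enum_enum /=.
under eq_bigl do rewrite (inj_eq g_inj).
(* The eigenvalue of X_n on the bra. For [k < i] the weight is the inverse of [theta] by [a_inv];
   for [k > i] the value of [theta] is 1. *)
have -> : \prod_(k < m.+1 | (k < i)%N) a (z (g i)) (z (g k)) =
    \prod_(k < m.+1 | k != i) (theta w z (g k) (g i))^-1.
  rewrite big_mkcond [RHS]big_mkcond; apply: eq_bigr => k _; rewrite /theta.
  have -> : (g k < g i)%N = (k < i)%N.
    case: (ltngtP k i) => [/gm//|/gm|/val_inj->]; last by rewrite ltnn.
    by move/ltnW; rewrite leqNgt => /negbTE.
  case: (ltngtP k i) => [ki|ki|/val_inj->]; rewrite ?eqxx ?invr1 -?val_eqE /=.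
  - rewrite ltn_eqF //; apply: (mulIf (x := a (z (g k)) (z (g i)))).
    by apply: contra_eq_neq (a_inv hunit (z (g k)) (z (g i))) => ->; rewrite mul0r eq_sym oner_eq0.
    rewrite a_inv // mulVf //.
    by apply: contra_eq_neq (a_inv hunit (z (g k)) (z (g i))) => ->; rewrite mul0r eq_sym oner_eq0.
  - by case: eqP.
  by [].
rewrite !prod_lift mulr_sumr; apply: eq_bigr => t _.
rewrite -enumT -index_enum_enum prod_ord_lt_recr big_ord_recr /= !lift_perm_id.
have lE k : g (lift_perm ord_max i t (lift ord_max k)) = g (lift i (t k)).
  by rewrite lift_perm_lift.
rewrite [X in _ = X * _ * _](_ : _ =
    \prod_(k < m) c (mu (lift ord_max k)) (z (g (lift i (t k))))); last first.
  by apply: eq_bigr => k _; rewrite widen_lift lE.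
rewrite [X in _ = _ * (X * _)](_ : _ =
   \prod_(j < m) \prod_(k < m | (j < k)%N)
     (b (mu (lift ord_max k)) (z (g (lift i (t j)))) *
      a (mu (lift ord_max j)) (z (g (lift i (t k)))) /
      (b (z (g (lift i (t k)))) (z (g (lift i (t j)))) *
       theta w z (g (lift i (t j))) (g (lift i (t k)))))); last first.
  by apply: eq_bigr => j _; apply: eq_bigr => k _; rewrite !lE.
(* These are the factors of the pairs [k = ord_max]. Two of the three products run over all
   remaining sites, so reindexing by [t] does not change them. *)
rewrite [X in _ = _ * (_ * X)](_ : _ =
   \prod_(k < m) (b (mu ord_max) (z (g (lift i k))) / b (z (g i)) (z (g (lift i k)))) *
   \prod_(k < m) (theta w z (g (lift i k)) (g i))^-1 *
   \prod_(j < m) a (mu (lift ord_max j)) (z (g i))); last first.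
  rewrite [X in _ = X * _ * _](reindex_perm t) [X in _ = _ * X * _](reindex_perm t) -!big_split.
  by apply: eq_bigr => j _; rewrite /= lE invfM; ring.
by ring.
Qed.

End PartitionFunction.

Theorem proposition8 (R : realType) (Lambda : Type) (w : weights Lambda R[i])
  (hunit : unitarity w) (hYB : yang_baxter w)
  (L : nat) (xi : 'I_L -> Lambda)
  (M : nat) (hM : (1 <= M <= L)%N)
  (l : 'I_M -> 'I_L) (hl : {homo l : j k / (j < k)%N})
  (mu : 'I_M -> Lambda)
  (hb : forall i j : 'I_L, i != j -> b_minus w (xi i) (xi j) != 0) :
  ZB w mu (fun k => xi (l k)) =
  \sum_(s : 'S_M)
    (\prod_(i < M) c_plus w (mu i) (xi (l (s i)))) *
    \prod_(j < M) \prod_(k < M | (j < k)%N)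
      ((b_minus w (mu k) (xi (l (s j))) * a_minus w (mu j) (xi (l (s k)))) /
       (b_minus w (xi (l (s k))) (xi (l (s j))) * theta w xi (l (s j)) (l (s k)))).
Proof.
(* As [l] is increasing, [theta] takes the same values on the chosen sites whether these are ordered
   in ['I_L] or in ['I_M]. *)
have l_lt j k : (l j < l k)%N = (j < k)%N.
  case: (ltngtP j k) => [/hl//|/hl/ltnW|/val_inj->]; last by rewrite ltnn.
  by rewrite leqNgt => /negbTE.
have l_inj j k : j != k -> l j != l k.
  by rewrite -!val_eqE /= !neq_ltn !l_lt.
rewrite (ZBE _ _ _ _ [ffun=> ord0]) -[in X in Zsites _ _ X](map_id (enum 'I_M)).
rewrite (Zsites_perm w M (fun k => xi (l k)) M id) // => [|j k /l_inj]; last exact: hb.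
apply: eq_bigr => s _; congr (_ * _); apply: eq_bigr => j _; apply: eq_bigr => k _.
by rewrite /theta l_lt.
Qed.
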